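(* Let $(X,d)$ and $(Y,\rho)$ be quasi-metric spaces and let $f:(X,d)\to(Y,\rho)$ be a function. Then the following statements are equivalent: (a) $f$ is left K-Cauchy regular; (b) for all sequences $(x_n)$ and $(y_n)$ in $X$, if $(x_n)$ is both left and right semi-equivalent to $(y_n)$ in $(X,d)$, then $(f(x_n))$ is both left and right semi-equivalent to $(f(y_n))$ in $(Y,\rho)$.
   Context: A quasi-metric on a set $X$ is a function $d:X\times X\to\mathbb{R}$ such that for all $x,y,z\in X$: $d(x,y)\ge 0$ and $d(x,x)=0$; $d(x,y)=0=d(y,x)$ implies $x=y$; and $d(x,y)\le d(x,z)+d(z,y)$ (symmetry is not required). A sequence $(x_n)$ in a quasi-metric space $(X,d)$ is left K-Cauchy if for every $\epsilon>0$ there is $n_0\in\mathbb{N}$ such that $d(x_k,x_n)<\epsilon$ whenever $n_0\le k\le n$. A map $f:(X,d)\to(Y,\rho)$ between quasi-metric spaces is left K-Cauchy regular if for every left K-Cauchy sequence $(x_n)$ in $(X,d)$, the sequence $(f(x_n))$ is left K-Cauchy in $(Y,\rho)$. For sequences $(x_n),(y_n)$ in $(X,d)$: $(x_n)$ is left semi-equivalent to $(y_n)$ if for every $\epsilon>0$ there is $n_0\in\mathbb{N}$ such that $d(x_m,y_n)<\epsilon$ for all $n_0\le m\le n$; $(x_n)$ is right semi-equivalent to $(y_n)$ if for every $\epsilon>0$ there is $n_0\in\mathbb{N}$ such that $d(y_m,x_n)<\epsilon$ for all $n_0\le m\le n$. *)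

(* Defs.v *)
From mathcomp Require Import all_boot all_order all_algebra.
From mathcomp Require Import reals.

Set Implicit Arguments.
Unset Strict Implicit.
Unset Printing Implicit Defensive.

Import Order.TTheory GRing.Theory Num.Theory.
Local Open Scope ring_scope.

Record is_quasi_metric (R : realType) (X : Type) (d : X -> X -> R) : Prop :=
  IsQuasiMetric {
    quasi_metric_ge0 : forall x y, 0 <= d x y;
    quasi_metric_refl : forall x, d x x = 0;
    quasi_metric_sep : forall x y, d x y = 0 -> d y x = 0 -> x = y;
    quasi_metric_triangle : forall x y z, d x y <= d x z + d z y
  }.

Definition left_K_cauchy (R : realType) (X : Type) (d : X -> X -> R)
    (x_ : nat -> X) : Prop :=
  forall e : R, 0 < e -> exists n0 : nat,
    forall k n : nat, (n0 <= k)%N -> (k <= n)%N -> d (x_ k) (x_ n) < e.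

Definition left_K_cauchy_regular (R : realType) (X Y : Type)
    (d : X -> X -> R) (rho : Y -> Y -> R) (f : X -> Y) : Prop :=
  forall x_ : nat -> X,
    left_K_cauchy d x_ -> left_K_cauchy rho (fun n => f (x_ n)).

Definition left_semi_equivalent (R : realType) (X : Type) (d : X -> X -> R)
    (x_ y_ : nat -> X) : Prop :=
  forall e : R, 0 < e -> exists n0 : nat,
    forall m n : nat, (n0 <= m)%N -> (m <= n)%N -> d (x_ m) (y_ n) < e.

Definition right_semi_equivalent (R : realType) (X : Type) (d : X -> X -> R)
    (x_ y_ : nat -> X) : Prop :=
  forall e : R, 0 < e -> exists n0 : nat,
    forall m n : nat, (n0 <= m)%N -> (m <= n)%N -> d (y_ m) (x_ n) < e.

(* Main.v *)
(* A sequence is left K-Cauchy iff it is left (equivalently right)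
   semi-equivalent to itself, which settles (b) => (a).  For (a) => (b), two
   sequences that are left and right semi-equivalent interleave into a left
   K-Cauchy sequence x_0, y_0, x_1, y_1, ...; comparing the entries 2m and 2n+1
   of its image gives left semi-equivalence of the images.  The interleaving
   starting with y_0 gives the right one: in the first interleaving y_m comes
   after x_m, so it says nothing about rho (f y_m) (f x_m). *)
Require Import Defs.
From mathcomp Require Import all_boot all_order all_algebra.
From mathcomp Require Import reals.

Import Order.TTheory GRing.Theory Num.Theory.
Local Open Scope ring_scope.

Definition interleave {X : Type} (x_ y_ : nat -> X) (n : nat) : X :=
  if odd n then y_ n./2 else x_ n./2.

(** Entries from different sequences compare directly. Two from the same sequence compare through
    the other sequence's entry of index [k./2], since semi-equivalence includes the diagonal case
    [m = n]. *)
Lemma left_K_cauchy_interleave (R : realType) (X : Type) (d : X -> X -> R)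
    (x_ y_ : nat -> X) :
  is_quasi_metric d -> left_semi_equivalent d x_ y_ ->
  right_semi_equivalent d x_ y_ -> left_K_cauchy d (interleave x_ y_).
Proof.
move=> hd hl hr e e_gt0.
have e2_gt0 : 0 < e / 2 by rewrite divr_gt0.
have e2_lt : e / 2 < e by rewrite ltr_pdivrMr // ltr_pMr // ltr1n.
have [n1 h1] := hl _ e2_gt0; have [n2 h2] := hr _ e2_gt0.
(* Doubled because position [k] holds an entry of index [k./2]. *)
exists (maxn n1 n2).*2 => k n le_k le_kn.
have: (maxn n1 n2 <= k./2)%N by rewrite geq_half_double.
rewrite geq_max => /andP[le1 le2].
have le_h : (k./2 <= n./2)%N by apply: half_leq.
rewrite /interleave; case: (odd k); case: (odd n).
- apply: le_lt_trans (quasi_metric_triangle hd _ _ (x_ k./2)) _.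
  by rewrite [e]splitr ltrD ?h1 ?h2.
- exact: lt_trans (h2 _ _ le2 le_h) e2_lt.
- exact: lt_trans (h1 _ _ le1 le_h) e2_lt.
- apply: le_lt_trans (quasi_metric_triangle hd _ _ (y_ k./2)) _.
  by rewrite [e]splitr ltrD ?h1 ?h2.
Qed.

Lemma regular_left_semi_equivalent (R : realType) (X Y : Type)
    (d : X -> X -> R) (rho : Y -> Y -> R) (f : X -> Y) (x_ y_ : nat -> X) :
  is_quasi_metric d -> left_K_cauchy_regular d rho f ->
  left_semi_equivalent d x_ y_ -> right_semi_equivalent d x_ y_ ->
  left_semi_equivalent rho (fun n => f (x_ n)) (fun n => f (y_ n)).
Proof.
move=> hd hf hl hr e e_gt0.
have [n0 h0] := hf _ (left_K_cauchy_interleave _ _ _ _ _ hd hl hr) _ e_gt0.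
exists n0 => m n le_m le_mn.
have := h0 m.*2 n.*2.+1; rewrite /interleave /= !odd_double doubleK uphalf_double.
apply; first by rewrite (leq_trans le_m) // -addnn leq_addr.
by rewrite leqW // leq_double.
Qed.

Theorem theorem3p6 (R : realType) (X Y : Type)
    (d : X -> X -> R) (rho : Y -> Y -> R)
    (hd : is_quasi_metric d) (hrho : is_quasi_metric rho) (f : X -> Y) :
  left_K_cauchy_regular d rho f <->
  (forall x_ y_ : nat -> X,
     left_semi_equivalent d x_ y_ /\ right_semi_equivalent d x_ y_ ->
     left_semi_equivalent rho (fun n => f (x_ n)) (fun n => f (y_ n)) /\
     right_semi_equivalent rho (fun n => f (x_ n)) (fun n => f (y_ n))).
Proof.
split=> [hf x_ y_ [hl hr]|h x_ hx].
  split; first exact: (regular_left_semi_equivalent _ _ _ _ _ _ x_ y_ hd hf hl hr).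
  (* Exchanging [x_] and [y_] turns left into right semi-equivalence by mere unfolding. *)
  exact: (regular_left_semi_equivalent _ _ _ _ _ _ y_ x_ hd hf hr hl).
by have [] := h x_ x_ (conj hx hx).
Qed.
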